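(* For every integer $k\geq 2$ and every finite generating set $X$ of the free inverse monoid $\mathrm{FIM}_k$ of rank $k$, the word problem $\mathrm{WP}(\mathrm{FIM}_k,X)$ is not poly-context-free, that is, it is not an intersection of finitely many context-free languages.
   Context: A monoid $M$ is inverse if for every $x\in M$ there is a unique $y\in M$ (the inverse $x^{-1}$ of $x$) with $xyx=x$ and $yxy=y$. For a set $X$, let $X^{-1}=\{\overline{x}\mid x\in X\}$ be a disjoint set of formal inverses and $X^{\pm}=X\cup X^{-1}$; put $x^{-1}=\overline{x}$ and $\overline{x}^{-1}=x$ for $x\in X$, and for a word $w=w_1\cdots w_n$ with $w_i\in X^{\pm}$ put $w^{\mathrm{inv}}=w_n^{-1}\cdots w_1^{-1}$. The free inverse monoid $\mathrm{FIM}(X)$ is the free object on $X$ in the variety of inverse monoids, i.e. the quotient of $(X^{\pm})^*$ by the relations $u=uu^{\mathrm{inv}}u$ and $uu^{\mathrm{inv}}vv^{\mathrm{inv}}=vv^{\mathrm{inv}}uu^{\mathrm{inv}}$ for $u,v\in (X^{\pm})^*$. If $|X|=k$ it is denoted $\mathrm{FIM}_k$. If $M$ is an inverse monoid and $X\subseteq M$ is a finite set generating $M$ as an inverse monoid, words over $X^{\pm}$ are evaluated in $M$ by interpreting $\overline{x}$ as the inverse of $x$, and $u=_M v$ means that $u$ and $v$ represent the same element of $M$. With $\#$ a symbol not in $X^{\pm}$, $$\mathrm{WP}(M,X)=\{u\#v^{\mathrm{inv}}\mid u,v\in (X^{\pm})^*,\ u=_M v\}.$$ *)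

(* Defs.v *)
From HB Require Import structures.
From mathcomp Require Import all_boot finmap generic_quotient.
From mathcomp Require Import boolp classical_sets.

Set Implicit Arguments.
Unset Strict Implicit.
Unset Printing Implicit Defensive.

Local Open Scope classical_set_scope.
Local Open Scope group_scope.

(* The two star-monoid laws ((x^-1)^-1 = x and (x * y)^-1 = y^-1 * x^-1) follow
   from the three axioms below, so every inverse monoid in the usual sense
   carries exactly one such structure. *)
HB.mixin Record StarMonoid_isInverseMonoid M & StarMonoid M := {
  mulgVg : forall x : M, x * x^-1 * x = x;
  mulVgV : forall x : M, x^-1 * x * x^-1 = x^-1;
  invg_uniq : forall x y : M, x * y * x = x -> y * x * y = y -> y = x^-1
}.

#[short(type="inverseMonoidType")]
HB.structure Definition InverseMonoid :=
  { M of StarMonoid_isInverseMonoid M & StarMonoid M }.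

Section Words.

Variable A : Type.

(* (x, false) is the letter x, (x, true) is its formal inverse. *)
Definition letter : Type := (A * bool)%type.

Definition linv (a : letter) : letter := (a.1, ~~ a.2).

Definition winv (w : seq letter) : seq letter := rev (map linv w).

Lemma linvK : involutive linv.
Proof. by case=> x b; rewrite /linv /= negbK. Qed.

Lemma winvK : involutive winv.
Proof.
move=> w; rewrite /winv map_rev revK -map_comp -[RHS]map_id.
by apply: eq_map => a /=; rewrite linvK.
Qed.

Lemma winv_cat u v : winv (u ++ v) = winv v ++ winv u.
Proof. by rewrite /winv map_cat rev_cat. Qed.

Inductive fim_cong : seq letter -> seq letter -> Prop :=
| fim_refl u : fim_cong u u
| fim_sym u v : fim_cong u v -> fim_cong v u
| fim_trans u v w : fim_cong u v -> fim_cong v w -> fim_cong u w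
| fim_cat u u' v v' :
    fim_cong u u' -> fim_cong v v' -> fim_cong (u ++ v) (u' ++ v')
| fim_regular u : fim_cong u (u ++ winv u ++ u)
| fim_comm u v :
    fim_cong (u ++ winv u ++ v ++ winv v) (v ++ winv v ++ u ++ winv u).

Lemma fim_winv u v : fim_cong u v -> fim_cong (winv u) (winv v).
Proof.
elim=> {u v} [u|u v _ IH|u v w _ IH1 _ IH2|u u' v v' _ IH1 _ IH2|u|u v].
- exact: fim_refl.
- exact: fim_sym.
- exact: fim_trans IH1 IH2.
- by rewrite !winv_cat; apply: fim_cat.
- by have := fim_regular (winv u); rewrite !winv_cat winvK catA.
- by rewrite !winv_cat !winvK -!catA; apply: fim_comm.
Qed.

End Words.

Section FreeInverseMonoid.

Variable A : choiceType.

Implicit Types u v : seq (letter A).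

(* Decidability of the congruence is not needed: it is reflected classically. *)
Definition fim_congb u v : bool := `[< fim_cong u v >].

Lemma fim_congb_refl : reflexive fim_congb.
Proof. by move=> u; apply/asboolP; apply: fim_refl. Qed.

Lemma fim_congb_sym : symmetric fim_congb.
Proof. by move=> u v; apply/asboolP/asboolP; apply: fim_sym. Qed.

Lemma fim_congb_trans : transitive fim_congb.
Proof.
by move=> v u w /asboolP uv /asboolP vw; apply/asboolP; apply: fim_trans uv vw.
Qed.

Canonical fim_equiv :=
  EquivRel fim_congb fim_congb_refl fim_congb_sym fim_congb_trans.

Local Open Scope quotient_scope.

Definition FIM : Type := {eq_quot fim_equiv}.

HB.instance Definition _ := Choice.on FIM.
HB.instance Definition _ := EqQuotient.on FIM.

Implicit Types x y e f : FIM.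

Definition fim_mul (x y : FIM) : FIM := \pi_FIM (repr x ++ repr y).
Definition fim_one : FIM := \pi_FIM [::].
Definition fim_inv (x : FIM) : FIM := \pi_FIM (winv (repr x)).

Lemma fim_piP u v : \pi_FIM u = \pi_FIM v <-> fim_cong u v.
Proof.
by split=> [/eqmodP /asboolP //|uv]; apply/eqmodP; apply/asboolP.
Qed.

Lemma fim_repr u : fim_cong (repr (\pi_FIM u)) u.
Proof. by apply/fim_piP; rewrite reprK. Qed.

Variant fim_spec : FIM -> Prop := FimSpec u : fim_spec (\pi_FIM u).

Lemma fimP x : fim_spec x.
Proof. by rewrite -[x]reprK; exact: FimSpec. Qed.

Lemma fim_mulE u v : fim_mul (\pi_FIM u) (\pi_FIM v) = \pi_FIM (u ++ v).
Proof. by apply/fim_piP; apply: fim_cat; apply: fim_repr. Qed.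

Lemma fim_invE u : fim_inv (\pi_FIM u) = \pi_FIM (winv u).
Proof. by apply/fim_piP; apply: fim_winv; apply: fim_repr. Qed.

Lemma fim_mulA : associative fim_mul.
Proof.
move=> x y z; case: (fimP x) (fimP y) (fimP z) => u [v] [w].
by rewrite !fim_mulE catA.
Qed.

Lemma fim_mul1 : left_id fim_one fim_mul.
Proof. by move=> x; case: (fimP x) => u; rewrite fim_mulE. Qed.

Lemma fim_invK : involutive fim_inv.
Proof. by move=> x; case: (fimP x) => u; rewrite !fim_invE winvK. Qed.

Lemma fim_invM : {morph fim_inv : x y / fim_mul x y >-> fim_mul y x}.
Proof.
move=> x y; case: (fimP x) (fimP y) => u [v].
by rewrite fim_mulE !fim_invE fim_mulE winv_cat.
Qed.

HB.instance Definition _ :=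
  isStarMonoid.Build FIM fim_mulA fim_mul1 fim_invK fim_invM.

Fact fim_mulgE u v : (\pi_FIM u : FIM) * \pi_FIM v = \pi_FIM (u ++ v).
Proof. exact: fim_mulE. Qed.

Fact fim_invgE u : (\pi_FIM u : FIM)^-1 = \pi_FIM (winv u).
Proof. exact: fim_invE. Qed.

Fact fim_mulgVg x : x * x^-1 * x = x.
Proof.
case: (fimP x) => u; rewrite fim_invgE !fim_mulgE -catA.
by apply/fim_piP; apply: fim_sym; apply: fim_regular.
Qed.

Fact fim_mulVgV x : x^-1 * x * x^-1 = x^-1.
Proof. by rewrite -[X in _ * X * _]invgK fim_mulgVg. Qed.

Fact fim_commP x y : x * x^-1 * (y * y^-1) = y * y^-1 * (x * x^-1).
Proof.
case: (fimP x) (fimP y) => u [v]; rewrite !fim_invgE !fim_mulgE -!catA.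
by apply/fim_piP; apply: fim_comm.
Qed.

Fact fim_idem e : e * e = e -> e * e^-1 = e.
Proof.
move=> ee; have eVeV : e^-1 * e^-1 = e^-1 by rewrite -invgM ee.
suff eVe : e^-1 = e by rewrite eVe.
have := fim_commP e^-1 e; rewrite invgK => comm.
have -> : e^-1 = e^-1 * e * (e * e^-1).
  by rewrite mulgA -(mulgA e^-1) ee fim_mulVgV.
by rewrite comm mulgA -(mulgA e) eVeV fim_mulgVg.
Qed.

Fact fim_idemC e f : e * e = e -> f * f = f -> e * f = f * e.
Proof.
by move=> /fim_idem ee /fim_idem ff; rewrite -ee -ff fim_commP.
Qed.

Fact fim_invg_uniq x y : x * y * x = x -> y * x * y = y -> y = x^-1.
Proof.
move=> xyx yxy; have xzx := fim_mulgVg x; have zxz := fim_mulVgV x.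
set z := x^-1 in xzx zxz *.
have idr (a b : FIM) : a * b * a = a -> (a * b) * (a * b) = a * b.
  by move=> aba; rewrite mulgA aba.
have xyz : x * y = x * z.
  have -> : x * y = x * z * (x * y) by rewrite mulgA xzx.
  by rewrite (fim_idemC (idr _ _ xzx) (idr _ _ xyx)) mulgA xyx.
have yxz : y * x = z * x.
  have -> : y * x = y * x * (z * x) by rewrite -mulgA (mulgA x) xzx.
  by rewrite (fim_idemC (idr _ _ yxy) (idr _ _ zxz)) -mulgA (mulgA x) xyx.
by rewrite -yxy yxz -mulgA xyz mulgA zxz.
Qed.

HB.instance Definition _ :=
  StarMonoid_isInverseMonoid.Build FIM fim_mulgVg fim_mulVgV fim_invg_uniq.

End FreeInverseMonoid.

Section WordProblem.

Variables (M : inverseMonoidType) (X : {fset M}).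

Definition generates : Prop :=
  forall S : set M,
    S 1 ->
    (forall x y, S x -> S y -> S (x * y)) ->
    (forall x, S x -> S x^-1) ->
    (forall x, x \in X -> S x) ->
    forall x, S x.

Definition eval_letter (a : letter X) : M :=
  if a.2 then (val a.1)^-1 else val a.1.

Definition eval_word (w : seq (letter X)) : M := \prod_(a <- w) eval_letter a.

(* The symbol # is None. *)
Definition word_problem : set (seq (option (X * bool))) :=
  [set w | exists u v : seq (letter X),
     eval_word u = eval_word v /\
     w = map Some u ++ None :: map Some (winv v)].

End WordProblem.

Arguments generates {M} X.
Arguments word_problem {M} X _.

Section ContextFree.

Variable T : finType.

Record cfg := Cfg {
  nonterm : finType;
  start : nonterm;
  rules : seq (nonterm * seq (nonterm + T))
}.

Inductive derives (G : cfg) :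
    seq (nonterm G + T) -> seq (nonterm G + T) -> Prop :=
| derives_refl s : derives s s
| derives_step s1 s2 n r t :
    (n, r) \in rules G ->
    derives (s1 ++ r ++ s2) t ->
    derives (s1 ++ inl n :: s2) t.

Definition cfg_lang (G : cfg) : set (seq T) :=
  [set w | derives [:: inl (start G)] (map inr w)].

Definition context_free (L : set (seq T)) : Prop :=
  exists G : cfg, L = cfg_lang G.

(* The degenerate case n = 0 adds nothing: the empty intersection is the set of
   all words, which is itself context-free. *)
Definition poly_context_free (L : set (seq T)) : Prop :=
  exists (n : nat) (K : 'I_n -> set (seq T)),
    (forall i, context_free (K i)) /\ L = \bigcap_i K i.

End ContextFree.

(* Main.v *)
(* For words x_1, ..., x_m of equal length in two free generators, the product of
   the idempotents x_j x_j^-1 has as Munn tree the union of the paths labelled by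
   the x_j.  Let u(s) be a word representing it, where s = (s_1, ..., s_m) and s_j
   determines x_j as a string marked with j.  Then u(s) # u(t) lies in the word
   problem exactly when s = t, since idempotents commute.
     Suppose that the word problem is the intersection of the languages of
   grammars G_1, ..., G_r.  In a parse tree of u(s) # u(s) for G_i take a lowest
   node whose yield is longer than half of the word.  The yields of its children,
   together with the (cyclically contiguous) rest of the word, are too short to
   contain both copies of a block s_j, and their boundaries cut only boundedly
   many blocks.  If m is large, some block j is thus cut in none of the r trees.
   There are polynomially many possible boundaries, but exponentially many values
   of a block, so two tuples s and t that differ only at such a j have the same
   productions and boundaries.  Exchanging pieces of the parse trees shows that
   every G_i generates u(s) # u(t), a contradiction. *)
Require Import Defs.
From mathcomp Require Import all_boot finmap zify.
From mathcomp Require Import generic_quotient boolp classical_sets.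

Set Implicit Arguments.
Unset Strict Implicit.
Unset Printing Implicit Defensive.

(** * Monotonicity of powers and of sequences *)

Lemma leq_wexp2r m n e : m <= n -> m ^ e <= n ^ e.
Proof. by case: e => // e mn; rewrite leq_exp2r. Qed.

Lemma leq_steps (c : nat -> nat) d i j :
  (forall l, l < d -> c l <= c l.+1) -> i <= j -> j <= d -> c i <= c j.
Proof.
move=> H; elim: j => [|j IH]; first by rewrite leqn0 => /eqP ->.
rewrite leq_eqVlt => /predU1P[-> //|ij jd].
exact: leq_trans (IH ij (ltnW jd)) (H _ jd).
Qed.

(** * Parse trees and their lowest large nodes *)

Section ParseTrees.

Variables (T : finType) (G : cfg T).

Local Notation sym := (nonterm G + T)%type.

(** Parse forests with their yields: induction over them exposes the children of a node, which a
    chain of rewriting steps hides. *)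
Inductive yields : seq sym -> seq T -> Prop :=
| yields_nil : yields [::] [::]
| yields_term a s w : yields s w -> yields (inr a :: s) (a :: w)
| yields_nonterm n r s w1 w2 :
    (n, r) \in rules G -> yields r w1 -> yields s w2 ->
    yields (inl n :: s) (w1 ++ w2).

Lemma yields_cat s1 s2 w1 w2 :
  yields s1 w1 -> yields s2 w2 -> yields (s1 ++ s2) (w1 ++ w2).
Proof.
move=> y1 y2; elim: y1 => [//|a s w _ IH|n r s w w' rG yr _ _ IH] /=.
  exact: yields_term.
by rewrite -catA; apply: yields_nonterm rG yr IH.
Qed.

Lemma yields_catP s1 s2 w : yields (s1 ++ s2) w ->
  exists w1 w2, [/\ w = w1 ++ w2, yields s1 w1 & yields s2 w2].
Proof.
elim: s1 w => [|x s1 IH] w /= y.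
  by exists [::], w; split=> //; apply: yields_nil.
case E: _ _ / y => [|a s v y|n r s v1 v2 rG yr y] //; case: E => ? ?; subst.
  have [w1 [w2 [-> y1 y2]]] := IH _ y.
  by exists (a :: w1), w2; split=> //; apply: yields_term.
have [w1 [w2 [-> y1 y2]]] := IH _ y.
exists (v1 ++ w1), w2; split=> //; first exact: catA.
exact: yields_nonterm rG yr y1.
Qed.

Lemma yields_map w : yields (map inr w) w.
Proof. by elim: w => [|a w IH]; [apply: yields_nil|apply: yields_term]. Qed.

Lemma derives_yields s w : derives s (map inr w) -> yields s w.
Proof.
move E: (map inr w) => t d; elim: d E => [{t}s <-|s1 s2 n r t' rG _ IH E].
  exact: yields_map.
have [v1 [v2 [-> y1 /yields_catP[v3 [v4 [-> y3 y4]]]]]] := yields_catP (IH E).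
by apply: yields_cat => //; apply: yields_nonterm rG y3 y4.
Qed.

Lemma derives_trans (s t u : seq sym) :
  derives s t -> derives t u -> derives s u.
Proof.
elim=> // s1 s2 n r v rG _ IH /IH; exact: derives_step.
Qed.

Lemma derives_ctx (p q s t : seq sym) :
  derives s t -> derives (p ++ s ++ q) (p ++ t ++ q).
Proof.
elim=> [{t}s|s1 s2 n r t' rG _ IH]; first exact: derives_refl.
rewrite -catA cat_cons catA; apply: derives_step rG _.
by move: IH; rewrite -!catA.
Qed.

Lemma yields_derives s w : yields s w -> derives s (map inr w).
Proof.
elim=> [|a {}s {}w _ IH|n r {}s w1 w2 rG _ IH1 _ IH2].
- exact: derives_refl.
- by have := derives_ctx [:: inr a] [::] IH; rewrite !cats0.
- apply: (@derives_step _ _ [::] s n r _ rG); rewrite /= map_cat.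
  apply: derives_trans (derives_ctx [::] s IH1) _.
  by have := derives_ctx (map inr w1) [::] IH2; rewrite !cats0.
Qed.

Lemma cfg_langP w : cfg_lang G w <-> yields [:: inl (start G)] w.
Proof. by split=> [/derives_yields|/yields_derives]. Qed.

Definition slice (z : seq T) a b := take (b - a) (drop a z).

(* The parse tree of z has a node labelled by rule, whose yield starts at c 0
   and whose l-th child yields the letters of z from c l to (c l.+1).-1; the
   yield of the node has length at least h, those of its children do not. *)
Record cut (h : nat) (rule : nonterm G * seq sym) (c : nat -> nat) (z : seq T)
    : Prop := Cut {
  cut_rule : rule \in rules G;
  cut_homo : forall l, l < size rule.2 -> c l <= c l.+1;
  cut_le_size : c (size rule.2) <= size z;
  cut_large : h <= c (size rule.2) - c 0;
  cut_small : forall l, l < size rule.2 -> c l.+1 - c l < h;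
  cut_outer : derives [:: inl (start G)]
    (map inr (take (c 0) z) ++ inl rule.1 :: map inr (drop (c (size rule.2)) z));
  cut_inner : forall l, l < size rule.2 ->
    yields [:: nth (inl (start G)) rule.2 l] (slice z (c l) (c l.+1))
}.

Lemma eq_cut h rule c c' z :
  (forall l, l <= size rule.2 -> c l = c' l) -> cut h rule c z ->
  cut h rule c' z.
Proof.
move=> cc' [ri ho le la sm ou inn].
split=> //; rewrite -?cc' // => l lr; rewrite -?cc' ?(ltnW lr) //; auto.
Qed.

Lemma yields_pieces s (ys : seq (seq T)) x0 :
  size ys = size s ->
  (forall l, l < size s -> yields [:: nth x0 s l] (nth [::] ys l)) ->
  yields s (flatten ys).
Proof.
elim: s ys => [|x s IH] [|y ys] //= => [_ _|[sz] H]; first exact: yields_nil.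
rewrite -cat1s; apply: yields_cat; first exact: (H 0).
by apply: IH => // l ls; apply: (H l.+1).
Qed.

Lemma flatten_slices (z : seq T) c d :
  (forall l, l < d -> c l <= c l.+1) ->
  flatten [seq slice z (c l) (c l.+1) | l <- iota 0 d] = slice z (c 0) (c d).
Proof.
elim: d => [|d IH] H; first by rewrite /slice subnn take0.
rewrite -[d.+1]addn1 iotaD map_cat flatten_cat IH; last by auto.
rewrite /= add0n cats0 /slice !addn1.
have c0d : c 0 <= c d := leq_steps H (leq0n d) (leqnSn d).
have cd := H d (ltnSn d).
have -> : c d.+1 - c 0 = (c d - c 0) + (c d.+1 - c d) by lia.
by rewrite takeD drop_drop subnK.
Qed.

(** Equal rules and boundaries mean that the same symbols govern the same regions of both words, so
    the outside and each child may be taken from either word independently. *)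
Lemma cut_interchange h rule c z1 z2 z :
  cut h rule c z1 -> cut h rule c z2 ->
  let d := size rule.2 in
  (take (c 0) z = take (c 0) z1 /\ drop (c d) z = drop (c d) z1) \/
  (take (c 0) z = take (c 0) z2 /\ drop (c d) z = drop (c d) z2) ->
  (forall l, l < d ->
     slice z (c l) (c l.+1) = slice z1 (c l) (c l.+1) \/
     slice z (c l) (c l.+1) = slice z2 (c l) (c l.+1)) ->
  cfg_lang G z.
Proof.
move=> C1 C2 d out inn; rewrite /cfg_lang /=.
have cho := cut_homo C1.
have c0d : c 0 <= c d := leq_steps cho (leq0n d) (leqnn d).
have zE : z = take (c 0) z ++ slice z (c 0) (c d) ++ drop (c d) z.
  rewrite -{1}(cat_take_drop (c 0) z); congr (_ ++ _).
  rewrite -{1}(cat_take_drop (c d - c 0) (drop (c 0) z)) drop_drop.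
  by rewrite subnK.
have D : derives [:: inl (start G)]
    (map inr (take (c 0) z) ++ inl rule.1 :: map inr (drop (c d) z)).
  by case: out => -[-> ->]; apply: cut_outer; [exact: C1|exact: C2].
rewrite {1}zE !map_cat; apply: derives_trans D _.
apply: (derives_step (r := rule.2)).
  by rewrite -surjective_pairing; exact: cut_rule C1.
apply: derives_ctx; apply: yields_derives.
rewrite -flatten_slices //; apply: (yields_pieces (x0 := inl (start G))).
  by rewrite size_map size_iota.
move=> l ld; rewrite (nth_map 0) ?size_iota // nth_iota // add0n.
by case: (inn l ld) => ->; [exact: (cut_inner C1 ld)|exact: (cut_inner C2 ld)].
Qed.

(** By induction on the forest, either every tree is short, or some tree has a lowest node with
    yield of length at least [h]; [1 < h] makes single letters short. *)
Lemma yields_lowest h s w : 1 < h -> yields s w ->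
  (exists ys, [/\ w = flatten ys, size ys = size s,
     (forall l, l < size s ->
        yields [:: nth (inl (start G)) s l] (nth [::] ys l)) &
     (forall l, l < size s -> size (nth [::] ys l) < h)]) \/
  (exists n r v ys v', [/\ (n, r) \in rules G, w = v ++ flatten ys ++ v',
     derives s (map inr v ++ inl n :: map inr v'), h <= size (flatten ys) &
     [/\ size ys = size r,
     (forall l, l < size r ->
        yields [:: nth (inl (start G)) r l] (nth [::] ys l)) &
     (forall l, l < size r -> size (nth [::] ys l) < h)]]).
Proof.
move=> h1; elim=> {s w} [|a s w _ IH|n r s w1 w2 rG yr IH1 ys2 IH2].
- by left; exists [::].
- case: IH => [[ys [-> sz Y S]]|[n [r [v [ys [v' [rG -> D L H]]]]]]].
    left; exists ([:: a] :: ys); split=> //=; first by rewrite sz.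
      case=> [_|l /Y //] /=; apply: yields_term; exact: yields_nil.
    by case=> [_|l /S].
  right; exists n, r, (a :: v), ys, v'; split=> //.
  by have := derives_ctx [:: inr a] [::] D; rewrite !cats0.
- case: IH1 => [[ys [w1E sz Y S]]|[n' [r' [v [ys [v' [rG' -> D L H]]]]]]]; last first.
    right; exists n', r', v, ys, (v' ++ w2); split=> //; first by rewrite !catA.
    apply: (@derives_step _ _ [::] s n r _ rG) => /=.
    apply: derives_trans (derives_ctx [::] s D) _.
    have := derives_ctx (map inr v ++ inl n' :: map inr v') [::]
      (yields_derives ys2).
    by rewrite !cats0 map_cat -!catA.
  have [big|small] := leqP h (size w1).
    right; exists n, r, [::], ys, w2; split=> //=; try by rewrite -?w1E.
    by have := derives_ctx [:: inl n] [::] (yields_derives ys2); rewrite !cats0.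
  case: IH2 => [[ys' [-> sz' Y' S']]|[n' [r' [v [ys' [v' [rG' -> D L H]]]]]]].
    left; exists (w1 :: ys'); split=> //=; first by rewrite sz'.
      case=> [_|l /Y' //] /=.
      by rewrite -[w1]cats0; apply: yields_nonterm rG yr yields_nil.
    by case=> [_|l /S'].
  right; exists n', r', (w1 ++ v), ys', v'; split=> //; first by rewrite !catA.
  apply: (@derives_step _ _ [::] s n r _ rG) => /=.
  apply: derives_trans (derives_ctx [::] s (yields_derives yr)) _.
  by have := derives_ctx (map inr w1) [::] D; rewrite !cats0 map_cat -!catA.
Qed.

Lemma cut_exists h w : 1 < h -> h <= size w -> cfg_lang G w ->
  exists rule c, cut h rule c w.
Proof.
move=> h1 hw /cfg_langP /(yields_lowest h1) [].
  (* The only tree yields all of [w], so it is not short. *)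
  case=> ys [wE sz _ /(_ 0 isT)]; move: hw; rewrite wE.
  by case: ys sz {wE} => [|y []] //= _; rewrite cats0; lia.
case=> n [r [v [ys [v' [rG wE D L [sz Y S]]]]]].
pose c l := size v + sumn (take l (shape ys)).
have c0 : c 0 = size v by rewrite /c take0 addn0.
have cr : c (size r) = size v + size (flatten ys).
  by rewrite /c -sz -(size_map size ys) take_size size_flatten.
have cS l : l < size r -> c l.+1 = c l + size (nth [::] ys l).
  move=> lr; rewrite /c (take_nth 0) ?size_map ?sz // sumn_rcons.
  by rewrite (nth_map [::]) ?sz // addnA.
exists (n, r), c; split=> //=; rewrite ?c0 ?cr.
- by move=> l /cS ->; lia.
- by rewrite wE !size_cat; lia.
- by rewrite addKn.
- by move=> l lr; rewrite cS // addKn S.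
- by rewrite wE take_size_cat // catA drop_size_cat // size_cat.
- move=> l lr; suff -> : slice w (c l) (c l.+1) = nth [::] ys l by exact: Y.
  rewrite /slice cS // addKn wE /c addnC -drop_drop drop_size_cat //.
  have lsz : l < size ys by rewrite sz.
  rewrite -{3}(cat_take_drop l ys) flatten_cat -catA /shape -map_take.
  rewrite -/(shape _) -size_flatten drop_size_cat //.
  by rewrite (drop_nth [::]) //= -catA take_size_cat.
Qed.

End ParseTrees.

(** * Pigeonhole principle and exchange of factors *)

Lemma pigeonhole_line m (V Col : finType) (chi : {ffun 'I_m -> V} -> Col)
    (dir : Col -> 'I_m) : #|Col| < #|V| ->
  exists s t : {ffun 'I_m -> V},
    [/\ s <> t, chi s = chi t & forall i, i != dir (chi s) -> s i = t i].
Proof.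
case: m chi dir => [|m] chi dir colV.
  have /card_gt0P[v _] : 0 < #|V| by lia.
  by case: (dir (chi [ffun=> v])).
(* Forgetting the coordinate selected by the colour leaves at most [#|Col| * #|V| ^ m] values for
   [#|V| ^ m.+1] tuples. *)
pose g (s : {ffun 'I_m.+1 -> V}) :=
  (chi s, [ffun i : 'I_m => s (lift (dir (chi s)) i)]).
have : ~ injective g.
  move/leq_card; rewrite card_prod !card_ffun !card_ord expnS.
  by rewrite leqNgt ltn_pmul2r ?colV // expn_gt0; apply/orP; left; lia.
move=> ninj; apply: contrapT => H; apply: ninj => s t [chist /ffunP st].
apply: contrapT => sDt; apply: H; exists s, t; split=> // i.
case: (unliftP (dir (chi s)) i) => [j ->|->]; last by rewrite eqxx.
by have := st j; rewrite !ffunE -chist.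
Qed.

Section Slices.

Variable T : finType.
Implicit Types u w x y z : seq T.

Lemma slice_nth z z' a b : size z = size z' ->
  (forall (x0 : T) i, a <= i < b -> nth x0 z i = nth x0 z' i) ->
  slice z a b = slice z' a b.
Proof.
move=> sz H; rewrite /slice.
have sE : size (take (b - a) (drop a z)) = size (take (b - a) (drop a z')).
  by rewrite !size_take !size_drop sz.
case: z z' sz H sE => [|x0 z] [|x1 z'] // sz H sE.
apply: (@eq_from_nth _ x0) => // i.
rewrite size_take => ib; have iba : i < b - a by move: ib; case: ifP; lia.
by rewrite !nth_take // !nth_drop; apply: H; lia.
Qed.

Lemma slice_take z a : slice z 0 a = take a z.
Proof. by rewrite /slice subn0 drop0. Qed.

Lemma slice_drop z a : slice z a (size z) = drop a z.
Proof. by rewrite /slice -size_drop take_size. Qed.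

Lemma slice_replace w x x' y a b : size x = size x' ->
  b <= size w \/ size w + size x <= a ->
  slice (w ++ x ++ y) a b = slice (w ++ x' ++ y) a b.
Proof.
move=> sx ab; apply: slice_nth => [|x0 i iab]; first by rewrite !size_cat sx.
rewrite !nth_cat sx; case: ifP => // iw; case: ifP => //; lia.
Qed.

End Slices.

(* A region of the cut containing the second marked factor misses the first one:
   children of the node are too short to contain both, and so is, cyclically,
   the part outside the node. *)
Lemma cut_cross (T : finType) (G : cfg T) rule c (p x x' q r : seq T) :
  let h := size x + size q in
  let intact l := ~~ (size p < c l < size p + size x) &&
    ~~ (size p + h < c l < size p + h + size x) in
  0 < size x -> size x = size x' -> size p <= size q -> size r <= size q ->
  (forall l, l <= size rule.2 -> intact l) ->
  @cut T G h rule c (p ++ x ++ q ++ x ++ r) ->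
  cut h rule c (p ++ x' ++ q ++ x' ++ r) ->
  cfg_lang G (p ++ x ++ q ++ x' ++ r).
Proof.
move=> h intact x0 sx pq rq cI C1 C2.
set z := p ++ _; set z1 := p ++ _ in C1; set z2 := p ++ _ in C2.
have sz1 : size z = size z1 by rewrite /z /z1 !size_cat sx.
have sz2 : size z = size z2 by rewrite /z /z2 !size_cat sx.
have szE : size z = size p + h + size x + size r.
  by rewrite /z !size_cat /h sx; lia.
have eq1 a b : b <= size p + h \/ size p + h + size x <= a ->
    slice z a b = slice z1 a b.
  have -> : z = (p ++ x ++ q) ++ x' ++ r by rewrite -!catA.
  have -> : z1 = (p ++ x ++ q) ++ x ++ r by rewrite -!catA.
  move=> ab; apply: slice_replace; rewrite ?size_cat -?sx //; move: ab; rewrite /h; lia.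
have eq2 a b : b <= size p \/ size p + size x <= a -> slice z a b = slice z2 a b.
  exact: slice_replace.
have lsz := cut_le_size C1; have lar := cut_large C1.
apply: (cut_interchange C1 C2) => [|l lr].
- rewrite -!slice_take -!slice_drop -?sz1 -?sz2.
  have /andP[_ I0] := cI 0 (leq0n _); have /andP[_ Id] := cI _ (leqnn _).
  (* A node of length at least [h] that ends before the second factor covers the first, as
     [size p <= size q]; one that ends after it begins no later than the second factor, as
     [size r <= size q]. *)
  have [le|gt] := leqP (c (size rule.2)) (size p + h).
    right; rewrite !(eq2 _ _) //; move: lar; rewrite /h; lia.
  by left; rewrite !(eq1 _ _) //; move: szE lar lsz Id; rewrite -sz1 /h; lia.
- have := cut_small C1 lr; have := cut_homo C1 lr.
  have /andP[Ia Ja] := cI l (ltnW lr); have /andP[Ib Jb] := cI l.+1 lr.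
  move=> ab abh.
  have [/andP[aV Vb]|nV] :=
    boolP ((c l <= size p + h) && (size p + h + size x <= c l.+1)).
    by right; apply: eq2; lia.
  by left; apply: eq1; lia.
Qed.

(** * Words composed of blocks, and exchange in an intersection of languages *)

Section Blocks.

Variables (T : finType) (m : nat) (V : finType) (B : nat).
Variable block : 'I_m -> V -> seq T.
Hypothesis size_block : forall j v, size (block j v) = B.

Definition blocks (s : {ffun 'I_m -> V}) : seq T :=
  flatten [seq block j (s j) | j <- enum 'I_m].

Lemma size_flatten_blocks (s : {ffun 'I_m -> V}) (l : seq 'I_m) :
  size (flatten [seq block j (s j) | j <- l]) = size l * B.
Proof.
by elim: l => //= j l IH; rewrite size_cat IH size_block mulSn.
Qed.

Lemma size_blocks s : size (blocks s) = m * B.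
Proof. by rewrite /blocks size_flatten_blocks size_enum_ord. Qed.

Lemma blocks_split (s t : {ffun 'I_m -> V}) (j : 'I_m) :
  (forall i, i != j -> s i = t i) ->
  exists w1 w2, [/\ blocks s = w1 ++ block j (s j) ++ w2,
    blocks t = w1 ++ block j (t j) ++ w2, size w1 = j * B &
    size w2 = (m - j.+1) * B].
Proof.
move=> st; have jm : j < size (enum 'I_m) by rewrite size_enum_ord.
pose l1 := take j (enum 'I_m); pose l2 := drop j.+1 (enum 'I_m).
have E : enum 'I_m = l1 ++ j :: l2.
  by rewrite -{1}(cat_take_drop j (enum 'I_m)) (drop_nth j) // nth_ord_enum.
have := enum_uniq 'I_m; rewrite E cat_uniq /= => /and3P[_ + /andP[jl2 _]].
rewrite negb_or => /andP[jl1 _].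
have eqst (l : seq 'I_m) : j \notin l ->
    [seq block i (t i) | i <- l] = [seq block i (s i) | i <- l].
  move=> jl; apply/eq_in_map => i il; rewrite st //.
  by apply: contraNneq jl => <-.
exists (flatten [seq block i (s i) | i <- l1]),
  (flatten [seq block i (s i) | i <- l2]).
rewrite /blocks E !map_cat !flatten_cat /= (eqst l1) // (eqst l2) //.
by rewrite !size_flatten_blocks size_drop size_takel size_enum_ord // ltnW.
Qed.

End Blocks.

(** Each of the [r * d] values of [f] excludes at most one index. *)
Lemma free_index m r d (c : 'I_r -> 'I_d -> nat) (f : nat -> nat) :
  r * d < m -> exists j : 'I_m, forall i l, f (c i l) <> j.
Proof.
move=> rdm; apply: contrapT => H.
have {}H (j : 'I_m) : exists il, f (c il.1 il.2) == j.
  apply: contrapT => Hj; apply: H; exists j => i l E; apply: Hj.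
  by exists (i, l); rewrite E.
pose g j := xchoose (H j).
have : injective g.
  move=> j j' E; apply: val_inj => /=.
  by rewrite -(eqP (xchooseP (H j))) -(eqP (xchooseP (H j'))) -/(g j) E.
by move/leq_card; rewrite card_prod !card_ord leqNgt rdm.
Qed.

(** The constants depend on the grammars only; block length and values are chosen afterwards, so
    exponentially many values can outgrow the bound [(a * B) ^ e]. *)
Lemma poly_context_free_copy (T : finType) (L : set (seq T)) :
  poly_context_free L ->
  exists m a e : nat, 0 < m /\ forall (B : nat) (V : finType)
      (block : 'I_m -> V -> seq T) (mark : T),
    0 < B -> (forall j v, size (block j v) = B) -> (a * B) ^ e < #|V| ->
    (forall s, L (blocks block s ++ mark :: blocks block s)) ->
    exists s t, s <> t /\ L (blocks block s ++ mark :: blocks block t).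
Proof.
case=> r [K [cfK LE]].
have [G KE] := choice cfK.
pose C := \max_(i < r) size (rules (G i)).
pose D := \max_(i < r) \max_(ru <- rules (G i)) size ru.2.
(* Each of the [r] cuts has at most [D.+1] boundaries, so one block stays uncut. *)
pose m := (r * D.+1).+1.
(* For each grammar, a colour holds one of [C.+1] rule indices and [D.+1] positions, with at most
   [4 * m * B] choices for each position. *)
exists m, (C.+1 * (4 * m)), (D.+1 * r); split=> // B V block mark B0 sB VB inL.
pose u := blocks block.
(* The distance between the two copies of a block, and more than half of the length
   [2 * m * B + 1]. *)
pose h := (m * B).+1.
pose n := (m * B + m * B).+2.
have su s : size (u s) = m * B by exact: size_blocks.
have sz s t : size (u s ++ mark :: u t) = n.-1.
  by rewrite size_cat /= !su addnS.
pose rule i (k : nat) := nth (start (G i), [::]) (rules (G i)) k.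
(* The grammars have different nonterminals, so a rule is stored by its index and one finite type of
   colours serves all of them. *)
pose Col := {ffun 'I_r -> 'I_C.+1 * {ffun 'I_D.+1 -> 'I_n}}%type.
pose cutat (col : 'I_C.+1 * {ffun 'I_D.+1 -> 'I_n}) l : nat := col.2 (inord l).
have cutP (si : {ffun 'I_m -> V} * 'I_r) :
    exists col : 'I_C.+1 * {ffun 'I_D.+1 -> 'I_n},
    size (rule si.2 col.1).2 <= D /\
    cut h (rule si.2 col.1) (cutat col) (u si.1 ++ mark :: u si.1).
  case: si => s i /=; set z := _ ++ _.
  have : cfg_lang (G i) z.
    by rewrite -KE; move: (inL s); rewrite LE => /(_ i); apply.
  case/(cut_exists (h := h)) => [||ru [c cc]].
  - by rewrite /h ltnS muln_gt0 B0.
  - by rewrite sz /n /h; lia.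
  have ruG := cut_rule cc.
  have ruD : size ru.2 <= D.
    apply: leq_trans (leq_bigmax i).
    exact: (@leq_bigmax_seq _ _ xpredT _ _ ruG isT).
  have ruC : index ru (rules (G i)) < C.+1.
    rewrite ltnS; apply: leq_trans (leq_bigmax i).
    exact: index_size.
  have ruE : rule i (inord (index ru (rules (G i))) : 'I_C.+1) = ru.
    by rewrite /rule inordK // nth_index.
  exists (inord (index ru (rules (G i))), [ffun l : 'I_D.+1 => inord (c l)]).
  rewrite /= ruE; split=> //.
  apply: (eq_cut _ cc) => l lr; rewrite /cutat /= ffunE.
  rewrite (inordK (n' := D)) ?ltnS ?(leq_trans lr) // inordK //.
  have cl := leq_steps (cut_homo cc) lr (leqnn _).
  by have := leq_trans cl (cut_le_size cc); rewrite sz.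
have [col colP] := choice cutP.
pose chi s : Col := [ffun i => col (s, i)].
(* The second copy starts at [h], just after the mark. The boundary [m * B] is sent to index 0,
   which is harmless: it too excludes a single block. *)
pose blockof p := (if p < m * B then p else p - h) %/ B.
have good (x : Col) : exists j : 'I_m, forall i (l : 'I_D.+1),
    blockof ((x i).2 l) <> j.
  exact: (free_index (fun i (l : 'I_D.+1) => (x i).2 l)).
have [dir dirP] := choice good.
have colV : #|Col| < #|V|.
  apply: leq_ltn_trans VB.
  rewrite card_ffun card_prod card_ffun !card_ord expnM.
  have mB0 : 0 < m * B by rewrite muln_gt0 B0.
  apply: leq_wexp2r; rewrite -mulnA expnMn; apply: leq_mul.
    by rewrite -{1}(expn1 C.+1) leq_pexp2l.
  by apply: leq_wexp2r; rewrite /n -mulnA; lia.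
have [s [t [sDt chist st]]] := pigeonhole_line chi dir colV.
exists s, t; split=> //; rewrite LE => i _; rewrite KE.
set j := dir (chi s) in st.
have [w1 [w2 [us ut sw1 sw2]]] := blocks_split sB st.
rewrite -!/(u _) in us ut *.
have [sD sC] := colP (s, i); have [tD tC] := colP (t, i).
have Ei : col (t, i) = col (s, i).
  by move/ffunP: chist => /(_ i); rewrite !ffunE.
rewrite {}Ei /= in tC tD; rewrite /= in sC sD.
set x := block j (s j) in us; set x' := block j (t j) in ut.
(* What separates the two copies of block [j]; its length is [h - B] for every [j]. *)
pose q := w2 ++ mark :: w1.
have zE (y y' : seq T) : (w1 ++ y ++ w2) ++ mark :: w1 ++ y' ++ w2 =
    w1 ++ y ++ q ++ y' ++ w2 by rewrite /q -!catA.
have hE : h = size x + size q.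
  rewrite /q size_cat /= sw1 sw2 sB /h mulnBl mulSn.
  have := leq_mul2r B j.+1 m; rewrite ltn_ord orbT mulSn => /idP; lia.
rewrite us ut !zE hE in sC tC *; apply: cut_cross sC tC.
- by rewrite sB.
- by rewrite !sB.
- by rewrite /q size_cat /=; lia.
- by rewrite /q size_cat leq_addr.
move=> l lr; have := dirP (chi s) i (inord l).
rewrite ffunE -/(cutat _ _) -/j; move: (cutat _ l) => p pj.
have divj o : j * B < o < j * B + B -> o %/ B = j.
  move=> /andP[o1 o2]; rewrite -(subnKC (ltnW o1)) divnMDl // divn_small ?addn0 //.
  lia.
rewrite -hE sw1 sB; apply/andP.
split; apply/negP => /andP[p1 p2]; apply: pj; rewrite /blockof.
  have pm : p < m * B.
    apply: leq_trans p2 _; rewrite addnC -mulSn.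
    by rewrite leq_mul2r ltn_ord orbT.
  by rewrite pm divj // p1.
have -> : (p < m * B) = false by apply/negbTE; rewrite -leqNgt /h in p1 *; lia.
by apply: divj; move: p1 p2; rewrite /h; lia.
Qed.

(** * Partial injections of a binary tree *)

Section PushPop.

Variables (A : Type) (f : A -> bool) (z : seq bool).

(* Letters act on the binary tree by partial injections, going from a node to a
   child and back; words [seq bool] list the turns from the node up to the root,
   and the edge entering z is deleted. *)
Definition step (a : letter A) (y : seq bool) : option (seq bool) :=
  if a.2 then
    if y is b :: y' then if (b == f a.1) && (y != z) then Some y' else None
    else None
  else if f a.1 :: y == z then None else Some (f a.1 :: y).

Fixpoint walk (w : seq (letter A)) (y : seq bool) : option (seq bool) :=
  if w is a :: w' then obind (walk w') (step a y) else Some y.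

Lemma step_linv a y y' : step a y = Some y' -> step (linv a) y' = Some y.
Proof.
case: a => x [] /=; rewrite /step /=.
  case: y => // b y; case: ifP => // /andP[/eqP -> yz] [<-].
  by rewrite (negbTE yz).
by case: eqVneq => // yz [<-]; rewrite eqxx yz.
Qed.

Lemma walk_cat u v y : walk (u ++ v) y = obind (walk v) (walk u y).
Proof. by elim: u y => //= a u IH y; case: (step a y). Qed.

Lemma walk_winv u y y' : walk u y = Some y' -> walk (winv u) y' = Some y.
Proof.
elim: u y => [|a u IH] y /=; first by case=> ->.
case E: (step a y) => [y1|] //= /IH.
rewrite /winv /= rev_cons -cats1 walk_cat => -> /=.
by rewrite (step_linv E).
Qed.

Lemma walk_idem u y :
  walk (u ++ winv u) y = if walk u y is Some _ then Some y else None.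
Proof. by rewrite walk_cat; case E: (walk u y) => //=; apply: walk_winv E. Qed.

(** The word [u ++ winv u] acts as the identity on the domain of [u]; such partial identities
    commute, so both defining relations hold. *)
Lemma walk_fim_cong u v : fim_cong u v -> walk u =1 walk v.
Proof.
elim=> {u v} [u|u v _ IH|u v w _ IH1 _ IH2|u u' v v' _ IH1 _ IH2|u|u v] y //.
- by rewrite IH1 IH2.
- by rewrite !walk_cat IH1; case: (walk u' y) => //= y'; rewrite IH2.
- rewrite catA walk_cat walk_idem.
  by case E: (walk u y) => //=; rewrite E.
- rewrite (catA u) (catA v) (walk_cat (u ++ _)) (walk_cat (v ++ _)) !walk_idem.
  case Eu: (walk u y) => /=; case Ev: (walk v y) => /=;
    by rewrite ?walk_idem ?Eu ?Ev.
Qed.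

(** A descending walk reaches the depth of [z] only with its last letter, so the deleted edge can
    block no earlier step. *)
Lemma walk_pos (x : seq A) y : 0 < size x -> size z = size x + size y ->
  walk [seq (c, false) | c <- x] y =
    if catrev (map f x) y == z then None else Some (catrev (map f x) y).
Proof.
elim: x y => [//|c [|c' x] IH] y _ sz; first by rewrite /= /step /=; case: ifP.
have stepE : step (c, false) y = Some (f c :: y).
  by rewrite /step /=; case: eqVneq sz => [<-|] //=; lia.
set w := [seq (d, false) | d <- c' :: x].
rewrite map_cons -/w -[LHS]/(obind (walk w) (step (c, false) y)) stepE.
by rewrite [LHS]IH //= sz addnS.
Qed.

Lemma walk_idems (I : Type) (s : seq I) (w : I -> seq (letter A)) y :
  walk (flatten [seq w i ++ winv (w i) | i <- s]) y =
    if all (fun i => walk (w i) y) s then Some y else None.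
Proof.
elim: s => //= i s IH; rewrite walk_cat walk_idem.
by case E: (walk (w i) y) => //=; rewrite IH.
Qed.

End PushPop.

(* The Munn trees of the two sides are the unions of the paths labelled by the
   x_i and by the x'_i; deleting the end of the path labelled by x_j leaves the
   second one intact. *)
Lemma idempotents_not_fim_cong (A : Type) (f : A -> bool) (L : nat)
    (I : eqType) (s : seq I) (x x' : I -> seq A) (j : I) :
  j \in s -> 0 < L -> (forall i, size (x i) = L) -> (forall i, size (x' i) = L) ->
  (forall i, i \in s -> map f (x' i) <> map f (x j)) ->
  let idem (y : I -> seq A) :=
    flatten [seq let w := [seq (c, false) | c <- y i] in w ++ winv w | i <- s] in
  ~ fim_cong (idem x) (idem x').
Proof.
move=> js L0 sx sx' neq /= /(@walk_fim_cong _ f (rev (map f (x j)))) /(_ [::]).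
have nz (y : I -> seq A) i : size (y i) = L -> 0 < size (y i) by move=> ->.
have sz (y : I -> seq A) i : size (y i) = L ->
    size (rev (map f (x j))) = size (y i) + size (@nil bool).
  by rewrite size_rev size_map sx addn0.
rewrite !walk_idems; case: ifP => [/allP H|_].
  by have := H _ js; rewrite walk_pos ?nz ?(sz x j) // eqxx.
case: ifP => // /allP H _; apply: H => i is_.
rewrite walk_pos ?nz ?(sz x' i) //; case: eqP => // /(congr1 rev).
by rewrite !revK => /(neq i is_).
Qed.

(** * Evaluation over a generating set *)

Section Evaluation.

Variables (A : choiceType) (X : {fset FIM A}).
Local Open Scope group_scope.
Local Open Scope quotient_scope.

Lemma eval_word_cat (u v : seq (letter X)) :
  eval_word (u ++ v) = eval_word u * eval_word v.
Proof. exact: big_cat. Qed.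

Lemma eval_letter_linv (a : letter X) : eval_letter (linv a) = (eval_letter a)^-1.
Proof. by case: a => a []; rewrite /eval_letter /= ?invgK. Qed.

Lemma eval_word_winv (u : seq (letter X)) : eval_word (winv u) = (eval_word u)^-1.
Proof.
elim: u => [|a u IH]; first by rewrite /eval_word !big_nil invg1.
rewrite /winv /= rev_cons -cats1 eval_word_cat IH /eval_word big_seq1 big_cons.
by rewrite eval_letter_linv invgM.
Qed.

Lemma generates_eval_word (x : FIM A) : generates X ->
  exists w : seq (letter X), eval_word w = x.
Proof.
move/(_ [set x | exists w : seq (letter X), eval_word w = x]%classic); apply.
- by exists [::]; rewrite /eval_word big_nil.
- by move=> _ _ [u <-] [v <-]; exists (u ++ v); rewrite eval_word_cat.
- by move=> _ [u <-]; exists (winv u); rewrite eval_word_winv.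
- move=> {}x xX; exists [:: (FSetSub xX, false)].
  by rewrite /eval_word big_seq1.
Qed.

Lemma eval_word_flatten (I : Type) (s : seq I) (g : I -> seq (letter X))
    (g' : I -> seq (letter A)) :
  (forall i, eval_word (g i) = \pi_(FIM A) (g' i)) ->
  eval_word (flatten (map g s)) = \pi_(FIM A) (flatten (map g' s)).
Proof.
move=> H; elim: s => [|i s IH] /=; first by rewrite /eval_word big_nil.
by rewrite eval_word_cat IH H fim_mulgE.
Qed.

End Evaluation.

(** Idempotents commute, so the product is idempotent and hence its own inverse. This removes the
    inversion of the second word in the word problem. *)
Lemma fim_idem_prod (A : choiceType) (I : Type) (s : seq I) (x : I -> FIM A) :
  let e := (\prod_(i <- s) (x i * (x i)^-1))%g in (e^-1 = e)%g.
Proof.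
move=> e; have ee : (e * e = e)%g.
  rewrite /e; elim: s {e} => [|i s IH]; first by rewrite big_nil mulg1.
  have pp : (x i * (x i)^-1 * (x i * (x i)^-1) = x i * (x i)^-1)%g.
    by rewrite mulgA fim_mulgVg.
  rewrite big_cons; move: (x i * _)%g pp (\prod_(j <- s) _)%g IH => p pp P PP.
  by rewrite -mulgA (mulgA P) -(fim_idemC pp PP) -(mulgA p) PP mulgA pp.
by have := fim_idem ee; move=> /[dup] E <-; rewrite invgM invgK.
Qed.

Lemma map_Some_None_inj (T : Type) (u u' v v' : seq T) :
  map Some u ++ None :: map Some v = map Some u' ++ None :: map Some v' ->
  u = u' /\ v = v'.
Proof.
elim: u u' => [|a u IH] [|a' u'] //= [].
  by move/(inj_map (fun _ _ E => Some_inj E)).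
by move=> -> /IH [-> ->].
Qed.

(** * Parameters, codes and the word problem of the free inverse monoid *)

Lemma polynomial_lt_exp a e : exists n, (a * n.+1) ^ e < 2 ^ n.
Proof.
case: e => [|e]; first by exists 1.
(* This [K] gives [a * n.+1 <= K ^ 2] for [n = 2 * K * e.+1], and [K < 2 ^ K]. *)
pose K := a.+1 * (2 * e.+1).+1; exists (2 * K * e.+1).
rewrite expnM ltn_exp2r // (mulnC 2 K) expnM.
have KK : a * (K * 2 * e.+1).+1 <= K ^ 2 by rewrite -mulnn /K; nia.
by apply: leq_ltn_trans KK _; rewrite ltn_exp2r // ltn_expl.
Qed.

(* Replacing each bit by a balanced pair makes the length of the image of a word
   under any substitution depend only on its length. *)
Definition balance (w : seq bool) : seq bool :=
  flatten [seq [:: b; ~~ b] | b <- w].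

Lemma balance_inj : injective balance.
Proof. by elim=> [|b w IH] [|b' w'] //= [-> _ /IH ->]. Qed.

Lemma size_balance w : size (balance w) = 2 * size w.
Proof. by elim: w => //= b w ->; rewrite mulnS. Qed.

Lemma size_subst_balance (T : Type) (g : bool -> seq T) w :
  size (flatten (map g (balance w))) = (size (g false) + size (g true)) * size w.
Proof.
elim: w => [|b w IH]; first by rewrite muln0.
by rewrite /= !size_cat IH mulnS; case: b => /=; lia.
Qed.

Theorem theorem5 (k : nat) (hk : (2 <= k)%N)
    (X : {fset FIM 'I_k}) (hX : generates X) :
  ~ poly_context_free (word_problem X).
Proof.
move=> /poly_context_free_copy [m [a [e [m0 copy]]]].
pose gen (b : bool) : 'I_k := Ordinal (leq_trans (leq_b1 b : b < 2) hk).
pose bit (i : 'I_k) : bool := i == 1 :> nat.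
have genK : cancel gen bit by case.
have [g evalg] := choice (fun b : bool =>
  generates_eval_word (\pi_(FIM 'I_k) [:: (gen b, false)])%qT hX).
pose l := size (g false) + size (g true).
have l0 : 0 < l.
  rewrite lt0n addn_eq0; apply/negP => /andP[/nilP g0 _].
  (* A free generator moves the root of the tree, so the empty word does not represent it. *)
  have := evalg false; rewrite g0 /eval_word big_nil => /fim_piP.
  by move=> /(@walk_fim_cong _ bit [::]) /(_ [::]).
(* Blocks will have [2 ^ N] values and length [2 * l * (m + N)], which is at most
   [2 * l * m.+1 * N.+1]. *)
have [N ltN] := polynomial_lt_exp (a * (2 * l * m.+1)) e.
pose V : finType := N.-tuple bool.
(* The indicator string of [j] keeps the codes of different blocks apart. *)
pose code (j : 'I_m) (v : V) := balance (mkseq (eqn j) m ++ v).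
have code_inj j j' v v' : code j v = code j' v' -> j = j' /\ v = v'.
  move=> /balance_inj /eqP; rewrite eqseq_cat ?size_mkseq //.
  move=> /andP[/eqP/(congr1 (nth false ^~ j)) + /eqP/val_inj ->].
  by rewrite !nth_mkseq // eqnE eqxx => /esym /eqP E; split=> //; apply: val_inj.
pose path j v := flatten (map g (code j v)).
pose idem j v := path j v ++ winv (path j v).
pose block j v := map Some (idem j v).
have size_path j v : size (path j v) = l * (m + N).
  by rewrite /path size_subst_balance size_cat size_mkseq size_tuple.
have size_block j v : size (block j v) = 2 * l * (m + N).
  rewrite /block size_map size_cat size_rev size_map size_path; lia.
have eval_path j v :
    eval_word (path j v) = \pi_(FIM 'I_k)%qT [seq (gen b, false) | b <- code j v].
  rewrite (eval_word_flatten _ evalg); congr (\pi_(_)%qT _).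
  by elim: (code j v) => //= b w ->.
pose word s := flatten [seq idem j (s j) | j <- enum 'I_m].
have blocksE s : blocks block s = map Some (word s).
  by rewrite /blocks /word map_flatten -map_comp.
have eval_word_idem s : ((eval_word (word s))^-1 = eval_word (word s))%g.
  suff -> : eval_word (word s) = (\prod_(j <- enum 'I_m)
      (eval_word (path j (s j)) * (eval_word (path j (s j)))^-1))%g.
    exact: fim_idem_prod.
  rewrite /word; elim: (enum _) => [|j r IH]; first by rewrite /eval_word !big_nil.
  by rewrite big_cons /= eval_word_cat IH eval_word_cat eval_word_winv.
have wpE s t : word_problem X (blocks block s ++ None :: blocks block t) <->
    eval_word (word s) = eval_word (word t).
  rewrite !blocksE; split=> [[u [v [uv]]]|st].
    move=> /map_Some_None_inj[-> tv].
    by rewrite uv -[v]winvK -tv eval_word_winv eval_word_idem.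
  exists (word s), (winv (word t)).
  by rewrite winvK eval_word_winv eval_word_idem.
have [||//|s [t [st /wpE]]] :=
    copy (2 * l * (m + N)) V block None _ size_block _ (fun s => (wpE s s).2 _).
- by rewrite !muln_gt0 l0 addn_gt0 m0.
- rewrite card_tuple card_bool; apply: leq_ltn_trans ltN.
  have le : a * (2 * l * (m + N)) <= a * (2 * l * m.+1) * N.+1.
    by rewrite -!mulnA !leq_mul2l; apply/orP; right; nia.
  exact: leq_wexp2r.
have [j sDt] : exists j, s j <> t j.
  apply: contrapT => H; apply: st; apply/ffunP => j; apply: contrapT => jst.
  by apply: H; exists j.
have idemE s' j' : eval_word (idem j' (s' j')) = \pi_(FIM 'I_k)%qT
   (let w := [seq (c, false) | c <- map gen (code j' (s' j'))] in w ++ winv w).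
  by rewrite eval_word_cat eval_word_winv eval_path fim_invgE fim_mulgE -map_comp.
rewrite !(eval_word_flatten _ (idemE _)) => /fim_piP.
apply: (idempotents_not_fim_cong (f := bit) (L := 2 * (m + N)) (j := j)).
- exact: mem_enum.
- by rewrite muln_gt0 addn_gt0 m0.
- by move=> i; rewrite size_map size_balance size_cat size_mkseq size_tuple.
- by move=> i; rewrite size_map size_balance size_cat size_mkseq size_tuple.
(* A path of [t] that coincides with path [j] of [s] carries the mark of [j], so it is path [j] of
   [t], and then [s j = t j]. *)
move=> i _; rewrite -!map_comp !(eq_map genK) !map_id => /code_inj[ij].
by move: sDt; rewrite -ij => ? ?; auto.
Qed.
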